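(* For every $\epsilon>0$ there exists an infinite sequence of positive integers $t_1<t_2<\cdots$ which contains no 3-term geometric progression, such that for every $n\ge 2$, \[ t_n-t_{n-1}\le \exp\left(2\sqrt{\log 2\,\log t_n+\tfrac{3+\epsilon}{2}\sqrt{\log 2\,\log t_n}\,\log\log t_n}\right). \]
   Context: A 3-term geometric progression is a triple of integers $(g_1,g_2,g_3)$ with $g_2=rg_1$ and $g_3=rg_2$ for some rational number $r>1$ (the ratio $r$ need not be an integer). A set of integers contains no 3-term geometric progression if no three of its elements form such a triple. Here $\log$ is the natural logarithm. *)

(* Defs.v *)
From mathcomp Require Import all_boot all_order all_algebra.
From mathcomp Require Import classical_sets.

Set Implicit Arguments.
Unset Strict Implicit.
Unset Printing Implicit Defensive.

Import GRing.Theory.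
Local Open Scope classical_set_scope.
Local Open Scope ring_scope.

Definition geom_prog3 (g1 g2 g3 : int) : Prop :=
  exists r : rat, [/\ 1 < r, g2%:Q = r * g1%:Q & g3%:Q = r * g2%:Q].

Definition geom_prog3_free (A : set int) : Prop :=
  forall g1 g2 g3 : int, A g1 -> A g2 -> A g3 -> ~ geom_prog3 g1 g2 g3.

(* Main.v *)
Require Import Defs.
From mathcomp Require Import all_boot all_order all_algebra.
From mathcomp Require Import classical_sets reals sequences exp.
From mathcomp Require Import ring lra zify.

(* Cut the integers near [2 ^ (k ^ 2)] into blocks of length [4 ^ k / 4] and choose
   one element in each, among those with no square divisor [d ^ 2] for
   [2 <= d <= q = 4 ^ (k - 3)]. If [c x ^ 2], [c x y], [c y ^ 2] are all chosen, then
   the primes of [x] and [y] are large for their size, in the sense that the sum of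
   [1 / lg p] over the primes of [x], or of [y], is at most [3 / 20]; and a number
   near [2 ^ (k ^ 2)] has at most [exp (3 k / 5)] such divisors. Hence [t = c x y]
   determines at most [exp (6 k / 5)] possible [c y ^ 2], far fewer than the number
   of candidates of a block, and one [c y ^ 2] rules out at most [exp (3 k / 5)]
   elements of the block of [t]. Choosing at random from the largest block
   downwards, the number of ruled-out elements of a block is a sum of small
   contributions with small total mean, so it is exponentially unlikely to be a
   positive proportion of the candidates. The conditional expectation method makes
   this deterministic for finitely many blocks, and compactness gives all of them. *)

Set Implicit Arguments.
Unset Strict Implicit.
Unset Printing Implicit Defensive.

Import Order.TTheory GRing.Theory Num.Theory.
Local Open Scope classical_set_scope.
Local Open Scope ring_scope.

(** * Divisors with large prime factors *)

Lemma ler_sum_subset (R : numDomainType) (I : eqType) (s r : seq I)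
    (F : I -> R) :
  uniq s -> {subset s <= r} -> (forall i, 0 <= F i) ->
  \sum_(i <- s) F i <= \sum_(i <- r) F i.
Proof.
move=> + + F_ge0; elim: s r => [|x s IHs] r /=.
  by move=> _ _; rewrite big_nil sumr_ge0.
move=> /andP[xs us] sub_r; have xr : x \in r by apply: sub_r; rewrite mem_head.
rewrite big_cons (big_rem x xr) /= lerD2l; apply: IHs => // y ys.
have /perm_mem/(_ y) := perm_to_rem xr; rewrite sub_r ?inE ?ys ?orbT //.
by case: eqVneq xs => [<-|_ _ /= <-//]; rewrite ys.
Qed.

Lemma nat_prime_ind (P : nat -> Prop) :
  P 1%N -> (forall p n, prime p -> (0 < n)%N -> P n -> P (p * n)%N) ->
  forall n, (0 < n)%N -> P n.
Proof.
move=> P1 PM n; elim/ltn_ind: n => n IHn n_gt0.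
have [n_le1|n_gt1] := leqP n 1.
  by have -> : n = 1%N by apply/eqP; rewrite eqn_leq n_le1.
have p_pr := pdiv_prime n_gt1; have /dvdnP[m nE] := pdiv_dvd n.
have m_gt0 : (0 < m)%N by case: m nE n_gt0 => // ->.
rewrite nE mulnC; apply: PM => //; apply: IHn => //.
by rewrite [X in (_ < X)%N]nE ltn_Pmulr // prime_gt1.
Qed.

(** Every divisor of [p * n] divides [n] or is [p] times a divisor of [n], so going from [n] to
    [p * n] multiplies the sum by at most [1 + w p <= exp (c * ln p)]. *)
Lemma sum_divisors_le (R : realType) (w : nat -> R) (c : R) :
  (forall d, 0 <= w d) -> w 1%N <= 1 ->
  (forall p d, prime p -> (0 < d)%N -> w (p * d)%N = w p * w d) ->
  (forall p, prime p -> w p <= c * ln p%:R) ->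
  forall n, (0 < n)%N -> \sum_(d <- divisors n) w d <= expR (c * ln n%:R).
Proof.
move=> w_ge0 w1 wM wp; apply: nat_prime_ind => [|p n p_pr n_gt0 IHn].
  by rewrite (_ : divisors 1 = [:: 1%N]) // big_seq1 ln1 mulr0 expR0.
have p_gt0 := prime_gt0 p_pr.
apply: (@le_trans _ _
  (\sum_(d <- divisors n ++ [seq (p * d)%N | d <- divisors n]) w d)).
  apply: ler_sum_subset => // [|d]; first exact: divisors_uniq.
  rewrite -dvdn_divisors ?muln_gt0 ?p_gt0 // => d_dvd.
  rewrite mem_cat -dvdn_divisors //.
  have [/dvdnP[e dE]|p_d] := boolP (p %| d)%N.
    apply/orP; right; apply/mapP; exists e; last by rewrite dE mulnC.
    by rewrite -dvdn_divisors // -(dvdn_pmul2l p_gt0) mulnC -dE.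
  by rewrite -(@Gauss_dvdr d p) ?d_dvd // coprime_sym prime_coprime.
rewrite big_cat big_map /= natrM lnM ?posrE ?ltr0n // mulrDr expRD.
have -> : \sum_(d <- divisors n) w (p * d)%N = w p * \sum_(d <- divisors n) w d.
  rewrite big_distrr /= big_seq [RHS]big_seq; apply: eq_bigr => d.
  by rewrite -dvdn_divisors // => /(dvdn_gt0 n_gt0) d_gt0; rewrite wM.
rewrite -[X in X + _]mul1r -mulrDl ler_pM ?addr_ge0 ?sumr_ge0 //.
by apply: le_trans (expR_ge1Dx _); rewrite lerD2l wp.
Qed.

Definition lg (R : realType) (n : nat) : R := ln n%:R / ln 2.

Section Log2.
Variable R : realType.
Notation lg := (lg R).

Lemma ln2_gt0 : 0 < ln 2 :> R.
Proof. by rewrite ln_gt0 // ltr1n. Qed.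

Lemma lgM m n : (0 < m)%N -> (0 < n)%N -> lg (m * n)%N = lg m + lg n.
Proof. by move=> m0 n0; rewrite /lg natrM lnM ?posrE ?ltr0n // mulrDl. Qed.

Lemma lgX2 k : lg (2 ^ k)%N = k%:R.
Proof.
by rewrite /lg natrX lnXn // -[_ *+ k]mulr_natl mulfK // gt_eqF // ln2_gt0.
Qed.

Lemma ler_lg m n : (0 < m)%N -> (m <= n)%N -> lg m <= lg n.
Proof.
move=> m0 mn; rewrite /lg ler_pM2r ?invr_gt0 ?ln2_gt0 //.
by rewrite ler_ln ?posrE ?ltr0n ?ler_nat // (leq_trans m0).
Qed.

Lemma lg_ge0 n : 0 <= lg n.
Proof.
case: n => [|n]; first by rewrite /lg ln0 // mul0r.
by rewrite divr_ge0 ?ln_ge0 ?(ltW ln2_gt0) // ler1n.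
Qed.

Lemma lg_gt0 n : (1 < n)%N -> 0 < lg n.
Proof. by move=> n1; rewrite divr_gt0 ?ln_gt0 ?ln2_gt0 // ltr1n. Qed.

(** Counting primes with multiplicity makes this completely additive; [logn p n] is 0 unless [p] is
    prime. *)
Definition ilg_sum (n : nat) : R :=
  \sum_(0 <= p < n.+1) (logn p n)%:R / lg p.

Lemma ilg_sum_widen n N : (n < N)%N ->
  ilg_sum n = \sum_(0 <= p < N) (logn p n)%:R / lg p.
Proof.
move=> nN; rewrite /ilg_sum [RHS](big_cat_nat (n := n.+1)) //=.
rewrite [X in _ + X]big_nat_cond [X in _ + X]big1 ?addr0 // => p.
rewrite andbT => /andP[np _]; by rewrite ltn_log0 ?mul0r.
Qed.

Lemma ilg_sum1 : ilg_sum 1 = 0.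
Proof. by apply: big1 => p _; rewrite logn1 mul0r. Qed.

Lemma ilg_sumM m n : (0 < m)%N -> (0 < n)%N ->
  ilg_sum (m * n)%N = ilg_sum m + ilg_sum n.
Proof.
move=> m0 n0; rewrite [ilg_sum m](@ilg_sum_widen _ (m * n)%N.+1) ?ltnS ?leq_pmulr //.
rewrite [ilg_sum n](@ilg_sum_widen _ (m * n)%N.+1) ?ltnS ?leq_pmull //.
by rewrite -big_split /=; apply: eq_bigr => p _; rewrite lognM // natrD mulrDl.
Qed.

Lemma ilg_sum_prime p : prime p -> ilg_sum p = (lg p)^-1.
Proof.
move=> pp; rewrite /ilg_sum big_nat_recr //= logn_prime // eqxx mul1r.
rewrite big_nat_cond big1 ?add0r // => q; rewrite andbT => /= qp.
by rewrite logn_prime // ltn_eqF // mul0r.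
Qed.

(** A prime contributes [1 / lg p <= lg p / c ^ 2], and the [lg p] add up to [lg n]. *)
Lemma ilg_sum_le (c : R) (n : nat) : 0 < c -> (0 < n)%N ->
  (forall p, prime p -> (p %| n)%N -> c <= lg p) -> ilg_sum n <= lg n / c ^+ 2.
Proof.
move=> c_gt0; move: n; apply: nat_prime_ind => [_|p n pp n0 IHn le_c].
  by rewrite ilg_sum1 mulr_ge0 ?lg_ge0 // invr_ge0 exprn_ge0 // ltW.
have p0 := prime_gt0 pp; rewrite ilg_sumM // lgM // mulrDl lerD //; last first.
  by apply: IHn => q qp qn; apply: le_c => //; apply: dvdn_mull.
rewrite ilg_sum_prime //; have cp := le_c _ pp (dvdn_mulr _ (dvdnn _)).
have p_gt0 : 0 < lg p by apply: lt_le_trans cp.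
by rewrite ler_pdivlMr ?exprn_gt0 // mulrC ler_pdivrMr // expr2 ler_pM // ltW.
Qed.

(* Rankin's trick with the completely multiplicative weight
   [exp (- 2 k ilg_sum d)], which is at most [lg p / (4 k)] at a prime [p]. *)
Lemma count_ilg_sum_le (k e : R) (n : nat) : 0 < k -> (0 < n)%N ->
  (count (fun d => ilg_sum d <= e) (divisors n))%:R
    <= expR (2 * k * e + lg n / (4 * k)).
Proof.
move=> k_gt0 n0.
pose w d := expR (- (2 * k * ilg_sum d)).
have /= := @sum_divisors_le R w (4 * k * ln 2)^-1 _ _ _ _ n n0.
have -> : (4 * k * ln 2)^-1 * ln n%:R = lg n / (4 * k).
  by rewrite /lg invfM mulrC [RHS]mulrAC mulrA.
move=> weights; rewrite expRD -ler_pdivrMl ?expR_gt0 // -expRN.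
apply: (le_trans _ (weights _ _ _ _)).
- rewrite -sum1_count natr_sum big_distrr /=.
  rewrite big_mkcond /= ler_sum // => d _.
  case: ifP => [de|_]; last exact: expR_ge0.
  by rewrite mulr1 ler_expR lerN2 ler_wpM2l // mulr_ge0 // ltW.
- by move=> d; apply: expR_ge0.
- by rewrite /w ilg_sum1 mulr0 oppr0 expR0.
- move=> p d pp d0; have p0 := prime_gt0 pp; rewrite /w ilg_sumM // -expRD.
  by congr expR; ring.
move=> p pp; rewrite /w ilg_sum_prime //.
have p_gt0 : 0 < lg p by rewrite lg_gt0 // prime_gt1.
have -> : (4 * k * ln 2)^-1 * ln p%:R = (4 * k / lg p)^-1.
  by rewrite [RHS]invfM invrK /lg invfM; ring.
rewrite expRN lef_pV2 ?posrE ?expR_gt0 ?(divr_gt0 _ p_gt0) ?mulr_gt0 //.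
(* What remains is [4 * v <= (1 + v) ^ 2 <= exp (2 * v)]. *)
set v := k / lg p; have v0 : 0 < v by rewrite divr_gt0.
have -> : 4 * k / lg p = 4 * v by rewrite mulrA.
have -> : 2 * k / lg p = v + v by rewrite /v; ring.
rewrite expRD; have := expR_ge1Dx v; set E := expR v => EV.
have : (1 + v) * (1 + v) <= E * E by apply: ler_pM => //; lra.
have := sqr_ge0 (1 - v); rewrite expr2; nra.
Qed.

End Log2.

(** * Choosing one element in each block *)

(** Koenig's lemma: as each [V i] is finite, a prefix that extends to solutions of every length has
    a one-step extension with the same property. *)
Lemma transversal_compactness (V : nat -> seq nat) (B : rel nat) :
  (forall M, exists f : nat -> nat,
    (forall i, (i < M)%N -> f i \in V i) /\
    (forall i j, (j < i)%N -> (i < M)%N -> ~~ B (f i) (f j))) ->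
  exists f : nat -> nat,
    (forall i, f i \in V i) /\ (forall i j, (j < i)%N -> ~~ B (f i) (f j)).
Proof.
pose P M (f : nat -> nat) := (forall i, (i < M)%N -> f i \in V i) /\
  (forall i j, (j < i)%N -> (i < M)%N -> ~~ B (f i) (f j)).
move=> exP; pose ext s := forall M, (size s <= M)%N ->
  exists f, P M f /\ mkseq f (size s) = s.
have ext_rcons s : exists v, ext s -> ext (rcons s v).
  have [ext_s|] := boolp.pselect (ext s); last by exists 0%N.
  apply: boolp.contrapT => /boolp.forallNP no_v.
  have /boolp.choice[bad badP] : forall v, exists M, (size s < M)%N /\
      forall f, P M f -> mkseq f (size s).+1 <> rcons s v.
    move=> v; apply: boolp.contrapT => /boolp.forallNP no_M; apply: (no_v v) => _ M.
    rewrite size_rcons => sM; apply: boolp.contrapT => /boolp.forallNP no_f.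
    by apply: (no_M M); split=> // f Pf fE; apply: (no_f f).
  (* If every next value [v] failed at some level [bad v], a solution reaching level [N], beyond all
     these levels, would refute the failure of its own entry. *)
  pose N := maxn (size s).+1 (\max_(v <- V (size s)) bad v).
  have sN : (size s < N)%N by rewrite leq_maxl.
  have [f [[f1 f2] fE]] := ext_s N (ltnW sN).
  have badN : (bad (f (size s)) <= N)%N.
    rewrite leq_max; apply/orP; right.
    by apply: (@leq_bigmax_seq _ _ _ bad) => //; apply: f1.
  case: (badP (f (size s))) => _ /(_ f); apply; last by rewrite mkseqS fE.
  by split=> [i|i j ji] iM; [apply: f1|apply: f2 => //]; apply: leq_trans badN.
have [next nextP] := boolp.choice ext_rcons.
pose pre := fix pre n := if n is m.+1 then rcons (pre m) (next (pre m)) else [::].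
have ext_pre n : ext (pre n).
  elim: n => [M _|n IHn]; last exact: nextP.
  by have [f Pf] := exP M; exists f.
pose f n := next (pre n).
have preE n : pre n = mkseq f n by elim: n => // n IHn; rewrite mkseqS -IHn.
have agree n : exists2 g, P n g & forall i, (i < n)%N -> g i = f i.
  have sz : size (pre n) = n by rewrite preE size_mkseq.
  have [g [Pg]] := ext_pre n n (eq_leq sz); rewrite sz preE => gf.
  by exists g => // i i_n; rewrite -(nth_mkseq 0%N g i_n) gf nth_mkseq.
exists f; split=> [i|i j ji]; have [g [g1 g2] gE] := agree i.+1.
  by rewrite -gE // g1.
by rewrite -!gE ?ltnS ?(ltnW ji) // g2.
Qed.

(** This follows from [exp (- u) >= 1 - u] and [(1 + 2 * u) * (1 - u) >= 1]. *)
Lemma expR_le_affine (R : realType) (u : R) :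
  0 <= u -> u <= 2^-1 -> expR u <= 1 + 2 * u.
Proof.
move=> u_ge0 u_le; rewrite -[u]opprK expRN; have := expR_ge1Dx (- u).
set E := expR _ => hE; have E0 : 0 < E by lra.
rewrite -[_^-1]mul1r ler_pdivrMr //; nra.
Qed.

Section GreedyTransversal.
Variables (R : realType) (V : nat -> seq nat) (B : rel nat).
(** In [V i], [A i] elements are to stay free and [T i] may be blocked; [Q j] bounds the expected
    number of hits on [V j], and [lam j] is the parameter of their exponential moment. *)
Variables (A T Q lam : nat -> R).

Let hits j s : R := (count (B s) (V j))%:R.

Hypothesis A_gt0 : forall i, 0 < A i.
Hypothesis lam_gt0 : forall j, 0 < lam j.
Hypothesis hits_le : forall i j s, (j < i)%N -> s \in V i -> lam j * hits j s <= 2^-1.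
Hypothesis V_size : forall j, A j + T j <= (size (V j))%:R.
Hypothesis Q_ge : forall j M,
  \sum_(j.+1 <= i < M) (\sum_(s <- V i) hits j s) / A i <= Q j.
Hypothesis expQ_le : forall j,
  expR (lam j * (2 * Q j - T j)) <= (j.+1%:R)^-1 - (j.+2%:R)^-1.

Let hits_ge0 j s : 0 <= hits j s. Proof. by rewrite /hits ler0n. Qed.

Let load j i : R := 2 * (\sum_(s <- V i) hits j s) / A i.

(* Conditional expectation of an exponential moment of the number of blocked
   elements of [V j], minus the threshold [T j], once the choices [f i] for
   [m <= i < M] are fixed: each choice still to come is pessimistically uniform
   on [A i] elements. *)
Let potential (f : nat -> nat) (m M : nat) (j : nat) : R :=
  expR (lam j * (\sum_(m <= i < M) hits j (f i) + \sum_(j.+1 <= i < m) load j i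
                 - T j)).

(** Indices are treated downwards from [M - 1], keeping the total potential of the untreated ones
    below 1. This leaves at least [A j] free elements when [j] is reached, and averaging over them
    yields a choice that preserves the invariant. *)
Lemma finite_transversal (M : nat) :
  exists f : nat -> nat,
    (forall i, (i < M)%N -> f i \in V i) /\
    (forall i j, (j < i)%N -> (i < M)%N -> ~~ B (f i) (f j)).
Proof.
suff partial d : (d <= M)%N -> exists f : nat -> nat,
    [/\ forall i, (M - d <= i < M)%N -> f i \in V i,
        forall i j, (M - d <= j)%N -> (j < i < M)%N -> ~~ B (f i) (f j)
      & \sum_(0 <= j < M - d) potential f (M - d) M j < 1].
  have [f [f1 f2 _]] := partial M (leqnn _); exists f; split=> [i iM|i j ji iM].
    by apply: f1; rewrite subnn.
  by apply: f2; rewrite ?subnn ?ji.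
elim: d => [_|d IHd dM].
  exists (fun=> 0%N); split=> [i|i j|].
  - by rewrite subn0 => /andP[Mi]; rewrite ltnNge Mi.
  - by rewrite subn0 => Mj /andP[ji /(ltn_trans ji)]; rewrite ltnNge Mj.
  (* Before any choice, [expQ_le] bounds the potentials by telescoping terms of sum
     [1 - 1 / (M + 1)]. *)
  rewrite subn0; apply: (@le_lt_trans _ _ (1 - (M.+1%:R)^-1)); last first.
    by rewrite ltrBlDr ltrDl invr_gt0.
  have -> : 1 - (M.+1%:R)^-1 = \sum_(0 <= j < M) ((j.+1%:R)^-1 - (j.+2%:R)^-1) :> R.
    elim: M => [|M IH]; first by rewrite big_geq // invr1 subrr.
    by rewrite big_nat_recr //= -IH; ring.
  apply: ler_sum => j _; apply: le_trans (expQ_le j).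
  rewrite ler_expR ler_pM2l // lerD2r (big_geq (leqnn M)) add0r.
  by rewrite (eq_bigr _ (fun i _ => esym (mulrA _ _ _))) -big_distrr /= ler_pM2l.
have [f [f1 f2 f3]] := IHd (ltnW dM); pose m := (M - d.+1)%N.
have mE : (M - d = m.+1)%N by rewrite /m subnS prednK // subn_gt0.
rewrite mE in f1 f2 f3; have mM : (m < M)%N by rewrite /m; lia.
pose ok t := all (fun i => ~~ B (f i) t) (index_iota m.+1 M).
pose avail := filter ok (V m).
have hits_lt : \sum_(m.+1 <= i < M) hits m (f i) < T m.
  have : potential f m.+1 M m < 1.
    apply: le_lt_trans f3; rewrite big_nat_recr //= lerDr.
    by apply: sumr_ge0 => j _; apply: expR_ge0.
  rewrite /potential (big_geq (leqnn _)) addr0 -[X in _ < X]expR0 ltr_expR.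
  by rewrite pmulr_rlt0 // subr_lt0.
have avail_ge : A m <= (size avail)%:R.
  have size_V : (size (V m) <=
      size avail + \sum_(m.+1 <= i < M) count (B (f i)) (V m))%N.
    rewrite /avail size_filter -(count_predC ok) leq_add2l /ok.
    elim: (index_iota _ _) => [|i r IHr] /=; first by rewrite big_nil count_pred0.
    rewrite big_cons; apply: leq_trans (leq_add (leqnn _) IHr).
    rewrite -count_predUI; apply: leq_trans (leq_addr _ _).
    by apply: sub_count => t /=; rewrite negb_and negbK.
  move: size_V; rewrite -(ler_nat R) natrD natr_sum => size_V.
  have := V_size m; move: hits_lt size_V; rewrite /hits; lra.
pose e j := potential f m.+1 M j.
pose g s j := expR (lam j * (\sum_(m.+1 <= i < M) hits j (f i)
   + \sum_(j.+1 <= i < m) load j i - T j + hits j s)).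
(* Averaged over [avail], which has at least [A m] elements, [exp (lam j * hits j s)] is at most [1
   + lam j * load j m <= exp (lam j * load j m)]: the pending load of [m] pays for the actual
   choice. *)
have sum_lt : \sum_(s <- avail) \sum_(0 <= j < m) g s j < (size avail)%:R.
  have e_lt : \sum_(0 <= j < m) e j < 1.
    apply: le_lt_trans f3; rewrite big_nat_recr //= lerDl; exact: expR_ge0.
  have sz_gt0 : 0 < (size avail)%:R :> R by apply: lt_le_trans avail_ge.
  rewrite -[X in _ < X]mulr1.
  apply: (@le_lt_trans _ _ ((size avail)%:R * \sum_(0 <= j < m) e j)); last first.
    by rewrite ltr_pM2l.
  rewrite exchange_big /= big_distrr /= big_nat [leRHS]big_nat.
  apply: ler_sum => j /andP[_ jm].
  rewrite /g /e /potential (big_nat_recr m) //= .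
  set S1 := \sum_(m.+1 <= i < M) _; set S2 := \sum_(j.+1 <= i < m) _.
  set E := expR (lam j * (S1 + S2 - T j)).
  have -> : lam j * (S1 + (S2 + load j m) - T j) =
    lam j * (S1 + S2 - T j) + lam j * load j m by ring.
  rewrite expRD -/E mulrCA.
  rewrite (eq_bigr (fun s => E * expR (lam j * hits j s))); last first.
    by move=> s _; rewrite mulrDr expRD.
  rewrite -big_distrr /= ler_pM2l ?expR_gt0 //.
  apply: (@le_trans _ _ (\sum_(s <- avail) (1 + 2 * (lam j * hits j s)))).
    rewrite big_seq [leRHS]big_seq; apply: ler_sum => s.
    rewrite mem_filter => /andP[_ sV].
    by apply: expR_le_affine (hits_le jm sV); rewrite mulr_ge0 // ltW.
  rewrite big_split /= big_const_seq count_predT iter_addr_0 -mulr_natr mul1r.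
  apply: (@le_trans _ _ ((size avail)%:R * (1 + lam j * load j m))); last first.
    by rewrite ler_pM2l // expR_ge1Dx.
  rewrite mulrDr mulr1 lerD2l -!big_distrr /= /load.
  have Vs : \sum_(s <- avail) hits j s <= \sum_(s <- V m) hits j s.
    rewrite big_filter big_mkcond /= ler_sum // => s _; case: ifP => // _.
  have S0 : 0 <= \sum_(s <- V m) hits j s.
    by rewrite sumr_ge0 // => s _; apply: hits_ge0.
  set S := \sum_(s <- V m) _ in Vs S0 *.
  have -> : (size avail)%:R * (lam j * (2 * S / A m)) =
    2 * (lam j * (S * ((size avail)%:R / A m))) by ring.
  rewrite ler_pM2l // ler_pM2l //; apply: le_trans Vs _.
  by rewrite ler_peMr // ler_pdivlMr // mul1r.
have [s sA s_lt] : exists2 s, s \in avail & \sum_(0 <= j < m) g s j < 1.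
  apply/hasP; apply: contraTT sum_lt => /hasPn sP; rewrite -leNgt.
  rewrite (_ : (size avail)%:R = \sum_(s <- avail) 1); last first.
    by rewrite big_const_seq count_predT iter_addr_0.
  by rewrite big_seq [leRHS]big_seq; apply: ler_sum => s sA; rewrite leNgt sP.
move: sA; rewrite mem_filter => /andP[/allP s_ok sV].
have f'E i : (m < i)%N -> (if i == m then s else f i) = f i.
  by move=> mi; rewrite gtn_eqF.
exists (fun i => if i == m then s else f i); rewrite -/m; split.
- move=> i /andP[]; rewrite leq_eqVlt => /orP[/eqP <- _|mi iM]; first by rewrite eqxx.
  by rewrite f'E // f1 // mi.
- move=> i j; rewrite leq_eqVlt => /orP[/eqP <-|mj] /andP[ji iM].
    by rewrite eqxx f'E // s_ok // mem_index_iota ji.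
  by rewrite !f'E ?(ltn_trans mj ji) // f2 // ji.
apply: le_lt_trans s_lt; apply: ler_sum => j _; rewrite /potential /g.
rewrite ler_expR ler_pM2l // (big_ltn mM) eqxx.
rewrite big_nat (eq_bigr (fun i => hits j (f i))); last first.
  by move=> i /andP[mi _]; rewrite f'E.
rewrite -big_nat; lra.
Qed.

End GreedyTransversal.

(** * The blocks *)

Lemma count_dvdn_iota (m a H : nat) : (0 < m)%N ->
  (count (dvdn m) (iota a.+1 H) + a %/ m = (a + H) %/ m)%N.
Proof.
move=> m_gt0; elim: H a => [|H IHH] a; first by rewrite addn0.
by rewrite /= addnAC -addnA -addSnnS -IHH divnS //; lia.
Qed.

Lemma count_dvdn_le (m a H : nat) : (0 < m)%N -> (0 < a)%N ->
  (count (dvdn m) (index_iota a (a + H)) <= (H %/ m).+1)%N.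
Proof.
move=> m_gt0; case: a => // a _; rewrite /index_iota addKn.
have := count_dvdn_iota a H m_gt0; have := leq_divDl m a H; lia.
Qed.

(** Telescoping with [1 / d ^ 2 < 1 / (d - 1) - 1 / d] for [d > 2]; the term [d = 2] is kept
    exact. *)
Lemma sum_inv_sqr_le (q : nat) :
  \sum_(2 <= d < q.+3) (d%:R ^- 2 : rat) <= 3 / 4 - q.+2%:R^-1.
Proof.
elim: q => [|q IHq]; first by rewrite big_nat1; lra.
rewrite big_nat_recr //=; apply: le_trans (lerD IHq (lexx _)) _.
have q0 : 0 < q.+2%:R :> rat by rewrite ltr0n.
have -> : q.+3%:R = q.+2%:R + 1 :> rat by rewrite -natr1.
set x : rat := q.+2%:R in q0 *; clearbody x.
rewrite -subr_ge0 (_ : _ - _ = (x * (x + 1) ^+ 2)^-1).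
  by rewrite invr_ge0 mulr_ge0 ?exprn_ge0 // ltW // addr_gt0.
have x10 : 0 < x + 1 by rewrite addr_gt0.
by field; rewrite !gt_eqF.
Qed.

Lemma sum_divn_sqr_le (q : nat) :
  (\sum_(2 <= d < q.+1) (16 * q) %/ d ^ 2 <= 12 * q)%N.
Proof.
case: q => [|[|q]]; try by rewrite big_geq.
rewrite -(ler_nat rat) natr_sum natrM.
apply: (@le_trans _ _ (\sum_(2 <= d < q.+3) (16 * q.+2%:R) * (d%:R ^- 2 : rat))).
  rewrite big_nat [leRHS]big_nat; apply: ler_sum => d /andP[d2 _].
  rewrite -natrX ler_pdivlMr ?ltr0n ?expn_gt0 ?(ltnW d2) //.
  by rewrite -!natrM ler_nat leq_trunc_div.
rewrite -big_distrr /=; have := sum_inv_sqr_le q.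
have q0 : 0 < q.+2%:R :> rat by rewrite ltr0n.
have : 0 < q.+2%:R^-1 :> rat by rewrite invr_gt0.
set S := \sum_(_ <= _ < _) _ => i0 S_le.
apply: (@le_trans _ _ (16 * q.+2%:R * (3 / 4))); last by lra.
by rewrite ler_pM2l ?mulr_gt0 //; apply: le_trans S_le _; rewrite gerBl ltW.
Qed.

(** At most [16 q / d ^ 2 + 1] of the [16 q] integers are multiples of [d ^ 2]; the main terms add
    up to at most [12 q] and the roundings to at most [q]. *)
Lemma size_squarefree_sieve (a q : nat) : (0 < a)%N ->
  (3 * q <= size [seq t <- index_iota a (a + 16 * q) |
     all (fun d => ~~ (d ^ 2 %| t)) (index_iota 2 q.+1)])%N.
Proof.
move=> a_gt0; rewrite size_filter.
set I := index_iota a _; set ok := fun t : nat => all _ _.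
have szI : size I = (16 * q)%N by rewrite size_iota addKn.
have : (size I <= count ok I + \sum_(2 <= d < q.+1) count (dvdn (d ^ 2)) I)%N.
  rewrite -(count_predC ok) leq_add2l /ok.
  elim: (index_iota 2 _) => [|i r IHr] /=; first by rewrite big_nil count_pred0.
  rewrite big_cons; apply: leq_trans (leq_add (leqnn _) IHr).
  rewrite -count_predUI; apply: leq_trans (leq_addr _ _).
  by apply: sub_count => t /=; rewrite negb_and negbK.
have : (\sum_(2 <= d < q.+1) count (dvdn (d ^ 2)) I <=
        \sum_(2 <= d < q.+1) ((16 * q) %/ d ^ 2 + 1))%N.
  rewrite big_nat [X in (_ <= X)%N]big_nat; apply: leq_sum => d /andP[d2 _].
  by rewrite addn1 count_dvdn_le // expn_gt0 (ltnW d2).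
rewrite big_split /= sum_nat_const_nat muln1; have := sum_divn_sqr_le q.
rewrite szI; lia.
Qed.

(** Take the largest [m], and write [y = u g], [m = v g] with [g] their gcd. Coprimality of [u] and
    [v] shows that [(u m) ^ 2] divides [s], so [u = 1] by maximality. *)
Lemma max_square_divisor (s : nat) : (0 < s)%N ->
  exists2 m, (m ^ 2 %| s)%N & forall y, (y ^ 2 %| s)%N -> (y %| m)%N.
Proof.
move=> s_gt0; pose P m := (m ^ 2 %| s)%N.
have exP : exists m, P m by exists 1%N; rewrite /P exp1n dvd1n.
have leP m : P m -> (m <= s)%N.
  move=> /(dvdn_leq s_gt0); apply: leq_trans; case: m => // m.
  by rewrite leq_pmull.
case: (ex_maxnP exP leP) => m Pm m_max; exists m => // y Py.
have /dvdnP[u yE] := dvdn_gcdl y m; have /dvdnP[v mE] := dvdn_gcdr y m.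
have m_gt0 : (0 < m)%N.
  by apply: (m_max 1%N); rewrite /P exp1n dvd1n.
have g_gt0 : (0 < gcdn y m)%N by rewrite gcdn_gt0 m_gt0 orbT.
have cuv : coprime u v.
  by rewrite /coprime -(eqn_pmul2r g_gt0) muln_gcdl -yE -mE mul1n.
have /dvdnP[s' sE] : (gcdn y m ^ 2 %| s)%N.
  by apply: dvdn_trans Pm; rewrite dvdn_exp2r // dvdn_gcdr.
have g2_gt0 : (0 < gcdn y m ^ 2)%N by rewrite expn_gt0 g_gt0.
have us : (u ^ 2 %| s')%N.
  by rewrite -(dvdn_pmul2r g2_gt0) -expnMn -yE -sE.
have vs : (v ^ 2 %| s')%N.
  by rewrite -(dvdn_pmul2r g2_gt0) -expnMn -mE -sE.
have : (u * m <= m)%N.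
  apply: m_max; rewrite /P {1}mE mulnA expnMn sE dvdn_pmul2r // expnMn Gauss_dvd ?us //.
  by rewrite coprimeXl // coprimeXr.
rewrite -[leqRHS]mul1n leq_pmul2r // => u1; rewrite yE.
case: u u1 yE {cuv us} => [_ y0|[_ _|//]]; last by rewrite mul1n dvdn_gcdr.
by move: Py s_gt0; rewrite y0 mul0n dvd0n => /eqP ->.
Qed.

(* The largest [k] with [2 ^ k ^ 2 <= n]; the admissible gap at [n] is then at
   least [4 ^ k]. *)
Definition scale (n : nat) : nat := (\max_(k < n.+1 | (2 ^ (k ^ 2) <= n)%N) k)%N.

Lemma scale_le n : (0 < n)%N -> (2 ^ (scale n ^ 2) <= n)%N.
Proof.
move=> n0; rewrite /scale; elim/big_ind: _ => // x y xn yn.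
by rewrite /maxn; case: ifP.
Qed.

Lemma scale_gt n : (n < 2 ^ ((scale n).+1 ^ 2))%N.
Proof.
rewrite ltnNge; apply/negP => le_n.
have ltn : ((scale n).+1 < n.+1)%N.
  rewrite ltnS; apply: leq_trans le_n.
  apply: leq_trans (ltnW (ltn_expl _ (ltnSn 1))).
  by rewrite -mulnn leq_pmulr.
have := @leq_bigmax_cond _ (fun k : 'I_n.+1 => (2 ^ (k ^ 2) <= n)%N)
  (@nat_of_ord _) (Ordinal ltn) le_n.
by rewrite -/(scale n) /= ltnn.
Qed.

Lemma leq_scale m n : (0 < m)%N -> (m <= n)%N -> (scale m <= scale n)%N.
Proof.
move=> m0 mn; have := leq_ltn_trans (leq_trans (scale_le m0) mn) (scale_gt n).
by rewrite ltn_exp2l // ltn_exp2r.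
Qed.

Lemma scale_exp2_sqr k : scale (2 ^ (k ^ 2)) = k.
Proof.
apply/eqP; rewrite eqn_leq; apply/andP; split.
  have := @scale_le (2 ^ (k ^ 2)); rewrite expn_gt0 => /(_ isT).
  by rewrite leq_exp2l // leq_exp2r.
by have := scale_gt (2 ^ (k ^ 2)); rewrite ltn_exp2l // ltn_exp2r.
Qed.

(** A block of length [16 * 4 ^ (k - 3) = 4 ^ k / 4] leaves room for two consecutive blocks within a
    gap of [4 ^ k]. *)
Definition sieve_bound (n : nat) : nat := (4 ^ (scale n - 3))%N.

Fixpoint block (K j : nat) : nat :=
  if j is i.+1 then (block K i + 16 * sieve_bound (block K i))%N
  else (2 ^ (K ^ 2))%N.

Definition candidates (K j : nat) : seq nat :=
  [seq t <- index_iota (block K j) (block K j.+1) |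
    all (fun d => ~~ (d ^ 2 %| t)%N) (index_iota 2 (sieve_bound (block K j)).+1)].

Section Blocks.
Variables (R : realType) (K : nat).
Hypothesis K_ge : (1000 <= K)%N.
Notation a := (block K).
Notation q := (fun j => sieve_bound (block K j)).
Notation k := (fun j => scale (block K j)).
Notation cand := (candidates K).

Lemma sieve_bound_gt0 n : (0 < sieve_bound n)%N.
Proof. by rewrite expn_gt0. Qed.

Lemma ltn_block i j : (i < j)%N -> (a i < a j)%N.
Proof.
elim: j => // j IHj; rewrite ltnS leq_eqVlt => /orP[/eqP ->|/IHj ij].
  by rewrite /= -[X in (X < _)%N]addn0 ltn_add2l muln_gt0 sieve_bound_gt0.
apply: ltn_trans ij _.
by rewrite /= -[X in (X < _)%N]addn0 ltn_add2l muln_gt0 sieve_bound_gt0.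
Qed.

Lemma leq_block i j : (i <= j)%N -> (a i <= a j)%N.
Proof. by rewrite leq_eqVlt => /orP[/eqP -> //|/ltn_block/ltnW]. Qed.

Lemma block_ge j : (j.+2 <= a j)%N.
Proof.
elim: j => [|j IHj]; last exact: leq_ltn_trans IHj (ltn_block _).
by apply: (@leq_trans (2 ^ 1)) => //; rewrite leq_exp2l // expn_gt0 (leq_trans _ K_ge).
Qed.

Lemma block_gt0 j : (0 < a j)%N.
Proof. exact: leq_trans (block_ge j). Qed.

Lemma scale_block_ge j : (1000 <= k j)%N.
Proof.
apply: leq_trans K_ge _; rewrite -[X in (X <= _)%N]scale_exp2_sqr.
by apply: leq_scale; [rewrite expn_gt0|apply: leq_block (leq0n j)].
Qed.

Lemma leq_sieve_bound i j : (i <= j)%N -> (q i <= q j)%N.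
Proof.
move=> ij; rewrite leq_exp2l // leq_sub2r // leq_scale ?block_gt0 //.
exact: leq_block.
Qed.

Lemma sieve_boundE j : (q j = 2 ^ (2 * (k j - 3)))%N.
Proof. by rewrite expnM. Qed.

(** A block is no longer than the square root of its left end: [(16 * q) ^ 2 = 2 ^ (4 * k - 4)]. *)
Lemma sqr_sieve_bound_le j : ((16 * q j) ^ 2 <= a j)%N.
Proof.
apply: leq_trans (scale_le (block_gt0 j)).
rewrite sieve_boundE -[16%N]/(2 ^ 4)%N -expnD -expnM leq_exp2l // -mulnn.
have := scale_block_ge j; move: (scale _) => x hx; nia.
Qed.

Lemma candidatesP j t : t \in cand j ->
  [/\ (a j <= t)%N, (t < a j + 16 * q j)%N &
      forall d, (2 <= d <= q j)%N -> ~~ (d ^ 2 %| t)%N].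
Proof.
rewrite mem_filter mem_index_iota => /andP[/allP sq_free /andP[-> ->]]; split=> // d hd.
by apply: sq_free; rewrite mem_index_iota ltnS.
Qed.

Lemma candidates_gt0 j t : t \in cand j -> (0 < t)%N.
Proof. by case/candidatesP => /(leq_trans (block_gt0 j)). Qed.

Lemma size_candidates_ge j : (3 * q j <= size (cand j))%N.
Proof. exact: size_squarefree_sieve (block_gt0 j). Qed.

Lemma size_candidates_le j : (size (cand j) <= 16 * q j)%N.
Proof.
by rewrite size_filter (leq_trans (count_size _ _)) // size_iota addKn.
Qed.

Notation kr := (fun j => (k j)%:R : R).

Lemma kr_ge j : 1000 <= kr j.
Proof. by rewrite ler_nat scale_block_ge. Qed.

(** Since [16 * q <= a], the block ends by [2 * a < 2 ^ ((k + 1) ^ 2 + 1)]. *)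
Lemma lg_candidates_le j t : t \in cand j -> lg R t <= (kr j + 1) ^+ 2 + 1.
Proof.
move=> tc; have [_ t_lt _] := candidatesP tc.
have -> : (kr j + 1) ^+ 2 + 1 = lg R (2 ^ ((k j).+1 ^ 2 + 1)).
  by rewrite lgX2 natrD natrX -natr1.
apply: ler_lg; first exact: candidates_gt0 tc.
rewrite addn1 expnS mul2n -addnn; apply: leq_trans (ltnW t_lt) _.
have := scale_gt (a j); set N := (2 ^ _)%N => aN.
have := sqr_sieve_bound_le j; rewrite -mulnn; nia.
Qed.

(* All primes [p] of [u] exceed the sieve bound [4 ^ (k - 3)], so [ilg_sum R u] is
   at most [lg u / (2 (k - 3)) ^ 2], while [lg u] is about [k ^ 2 / 2]. The limit
   value [1 / 8] does not depend on the scale. *)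
Lemma ilg_sum_candidates j t u : t \in cand j -> (u ^ 2 %| t)%N ->
  ilg_sum R u <= 3 / 20.
Proof.
move=> tc ut; have [_ _ t_free] := candidatesP tc.
have t0 := candidates_gt0 tc.
have u0 : (0 < u)%N by case: u ut t0 => //; rewrite dvd0n => /eqP ->.
have k1000 := kr_ge j; pose c : R := 2 * (kr j - 3).
have c_gt0 : 0 < c by rewrite /c; lra.
apply: (@le_trans _ _ (lg R u / c ^+ 2)).
  apply: ilg_sum_le => // p pp pu.
  have -> : c = lg R (q j).
    rewrite sieve_boundE lgX2 natrM natrB //.
    exact: leq_trans (scale_block_ge j).
  apply: ler_lg; first exact: sieve_bound_gt0.
  rewrite leqNgt; apply/negP => pq.
  have := t_free p; rewrite prime_gt1 //= (ltnW pq) => /(_ isT) /negP; apply.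
  by apply: dvdn_trans ut; rewrite dvdn_exp2r.
rewrite ler_pdivrMr ?exprn_gt0 //.
have : lg R u + lg R u <= (kr j + 1) ^+ 2 + 1.
  rewrite -lgM // mulnn; apply: le_trans (lg_candidates_le tc).
  by apply: ler_lg; [rewrite expn_gt0 u0|apply: dvdn_leq].
(* The margin from [1 / 8] to [3 / 20] gives [(k + 1) ^ 2 + 1 <= 6 / 5 * (k - 3) ^ 2]. *)
move: k1000; rewrite /c; move: (kr j) => x hx; nra.
Qed.

End Blocks.

(** * Blocked candidates *)

Section Blocking.
Variables (R : realType) (K : nat).
Hypothesis K_ge : (1000 <= K)%N.
Notation a := (block K).
Notation q := (fun j => sieve_bound (block K j)).
Notation cand := (candidates K).
Notation kr := (fun j => (scale (block K j))%:R : R).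

(** By [ilg_sum_candidates], this contains [x] and [y] whenever [c x ^ 2], [t = c x y] and [c y ^ 2]
    are candidates. *)
Definition admissible (t : nat) : seq nat :=
  [seq x <- divisors t | ilg_sum R x <= 3 / 20].

(* [s = c y ^ 2] and [t = c x y]: the last two terms of a progression. *)
Definition blocks (s t : nat) : bool :=
  has (fun y => (y ^ 2 %| s)%N && has (fun x => (s * x == t * y)%N) (admissible t))
      (admissible t).

(** Rankin's bound with parameter [k]: the exponent is [3 k / 10] plus [lg n / (4 k)], which is
    about [k / 4] and at most [3 k / 10]. *)
Lemma count_admissible_le j t n : t \in cand j -> (0 < n)%N -> (n <= t)%N ->
  (size [seq x <- divisors n | ilg_sum R x <= 3 / 20])%:R <= expR (3 / 5 * kr j).
Proof.
move=> tc n0 nt; have k1000 := kr_ge R K_ge j.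
have k0 : 0 < kr j by lra.
rewrite size_filter; apply: le_trans (count_ilg_sum_le _ k0 n0) _.
rewrite ler_expR.
have lgn : lg R n <= (kr j + 1) ^+ 2 + 1.
  by apply: le_trans (ler_lg R n0 nt) (lg_candidates_le R K_ge tc).
have : lg R n / (4 * kr j) <= 3 / 10 * kr j.
  rewrite ler_pdivrMr ?mulr_gt0 //; move: k1000 lgn; move: (kr j) => x; nra.
move: (kr j) => x; lra.
Qed.

(** The blocks are disjoint, and [s = t y / x] is determined by the pair [(x, y)]. *)
Lemma sum_blocks_le j M t : t \in cand j ->
  (\sum_(j.+1 <= i < M) count (blocks^~ t) (cand i) <= size (admissible t) ^ 2)%N.
Proof.
move=> tc; have t0 := candidates_gt0 K_ge tc.
apply: (@leq_trans (count (blocks^~ t) (index_iota (a j.+1) (a M)))).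
  have [jM|Mj] := leqP j.+1 M; last by rewrite big_geq // ltnW.
  elim: M jM => [//|M IHM]; rewrite leq_eqVlt => /orP[/eqP <-|jM].
    by rewrite big_geq.
  have -> : index_iota (a j.+1) (a M.+1) =
      index_iota (a j.+1) (a M) ++ index_iota (a M) (a M.+1).
    have := leq_block K (jM : (j.+1 <= M)%N); have := leq_block K (leqnSn M).
    rewrite /index_iota.
    move: (a j.+1) (a M) (a M.+1) => x y z yz xy.
    rewrite -[X in _ ++ iota X _](subnKC xy) -iotaD; congr iota; lia.
  rewrite big_nat_recr // count_cat leq_add ?IHM // /candidates count_filter.
  by apply: sub_count => t' /= /andP[].
pose nb := [seq (t * y %/ x)%N | x <- admissible t, y <- admissible t].
rewrite -mulnn -(size_allpairs (fun x y => (t * y %/ x)%N)) -/nb -size_filter.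
apply: uniq_leq_size; first by rewrite filter_uniq // iota_uniq.
move=> s; rewrite mem_filter => /andP[/hasP[y ya /andP[_ /hasP[x xa /eqP sxy]]] _].
apply/allpairsP; exists (x, y); split=> //=; rewrite -sxy mulnK //.
by move: xa; rewrite mem_filter -dvdn_divisors // => /andP[_ /(dvdn_gt0 t0)].
Qed.

(** Within one block, [y] determines [t], a multiple of [s / y], which is at least the block length.
    All such [y] divide the largest [m] whose square divides [s], so it suffices to count divisors
    of [m]. *)
Lemma count_blocks_le i j s : (j < i)%N -> s \in cand i ->
  (count (blocks s) (cand j))%:R <= expR (3 / 5 * kr j).
Proof.
move=> ji sc; have s0 := candidates_gt0 K_ge sc.
have [/hasP[t0 t0c t0b]|/hasPn no_t] := boolP (has (blocks s) (cand j)); last first.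
  rewrite (_ : count _ _ = 0%N) ?expR_ge0 //.
  by apply/eqP; rewrite -leqn0 leqNgt -has_count; apply/hasPn.
have t0_gt0 := candidates_gt0 K_ge t0c.
have [m m2 m_max] := max_square_divisor s0.
have m0 : (0 < m)%N.
  by case: m m2 {m_max} => //; rewrite dvd0n => /eqP s0'; rewrite s0' in s0.
(* This keeps the bound at the scale of block [j], however large [s] is:
   [m ^ 2 <= s <= s x = t0 y <= t0 ^ 2]. *)
have mt : (m <= t0)%N.
  rewrite -leq_sqr; apply: leq_trans (dvdn_leq s0 m2) _.
  case/hasP: t0b => y; rewrite mem_filter -dvdn_divisors // => /andP[_ yt].
  case/andP=> _ /hasP[x]; rewrite mem_filter -dvdn_divisors // => /andP[_ xt] /eqP sxy.
  have x0 := dvdn_gt0 t0_gt0 xt; have yt' := dvdn_leq t0_gt0 yt.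
  by apply: (@leq_trans (s * x)); rewrite ?leq_pmulr // sxy -mulnn leq_mul2l yt' orbT.
apply: le_trans (count_admissible_le t0c m0 mt); rewrite ler_nat -size_filter.
pose P t y := (y ^ 2 %| s)%N && has (fun x => (s * x == t * y)%N) (admissible t).
pose root t := nth 0%N (admissible t) (find (P t) (admissible t)).
have rootP t : blocks s t -> (root t \in admissible t) /\ P t (root t).
  by move=> bt; split; [rewrite mem_nth // -has_find|apply: nth_find].
rewrite -(size_map root); apply: uniq_leq_size.
  rewrite map_inj_in_uniq ?filter_uniq ?iota_uniq // => t t'.
  rewrite !(mem_filter (blocks s)) => /andP[/rootP[_ Pt] tc].
  move=> /andP[/rootP[_ Pt'] tc'] rE.
  rewrite -rE in Pt'; move: Pt Pt'; set y := root t => {rE}.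
  move=> /andP[/dvdnP[c sE] /hasP[x _ /eqP sx]] /andP[_ /hasP[x' _ /eqP sx']].
  have y0 : (0 < y)%N.
    by rewrite lt0n; apply: contraTneq s0 => y0; rewrite sE y0 muln0.
  have tE : t = (c * y * x)%N.
    by apply/eqP; rewrite -(eqn_pmul2r y0) -sx sE; apply/eqP; ring.
  have tE' : t' = (c * y * x')%N.
    by apply/eqP; rewrite -(eqn_pmul2r y0) -sx' sE; apply/eqP; ring.
  have [t1 t2 _] := candidatesP tc; have [t1' t2' _] := candidatesP tc'.
  have c0 : (0 < c)%N by rewrite lt0n; apply: contraTneq s0 => c0; rewrite sE c0.
  (* The chain is [(16 * q j) ^ 2 <= a j <= s = c y ^ 2 <= (c y) ^ 2]. *)
  have cy : (16 * q j <= c * y)%N.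
    rewrite -leq_sqr; apply: leq_trans (sqr_sieve_bound_le K_ge j) _.
    have [as_ _ _] := candidatesP sc; apply: leq_trans (leq_trans as_ _).
      by rewrite leq_block // ltnW.
    by rewrite sE expnMn leq_pmul2r ?expn_gt0 ?y0 // -mulnn leq_pmulr.
  have [xx'|xx'|xx'] := ltngtP x x'; last by rewrite tE tE' xx'.
    have : (c * y * x + c * y <= c * y * x')%N by rewrite -mulnSr leq_mul2l xx' orbT.
    lia.
  have : (c * y * x' + c * y <= c * y * x)%N by rewrite -mulnSr leq_mul2l xx' orbT.
  lia.
move=> y /mapP[t]; rewrite mem_filter => /andP[/rootP[rt /andP[rs _]] tc ->].
by move: rt; rewrite !mem_filter => /andP[-> _]; rewrite -dvdn_divisors // m_max.
Qed.

End Blocking.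

(** * Exponential inequalities *)

(** Here [exp (1 / 8) <= 1 / (1 - 1 / 8) = 8 / 7], and [(8 / 7) ^ 10 < 4]. *)
Lemma expR_5_4_le (R : realType) : expR (5 / 4) <= 4 :> R.
Proof.
have E8 : expR (8^-1) <= 8 / 7 :> R.
  rewrite -[8^-1]opprK expRN -[leRHS]invrK lef_pV2 ?posrE ?expR_gt0 ?invr_gt0 //;
    try lra.
  by apply: le_trans (expR_ge1Dx _); lra.
rewrite (_ : 5 / 4 = 10%:R * 8^-1); last by lra.
rewrite expRM_natl.
have : expR (8^-1) ^+ 10 <= (8 / 7) ^+ 10 :> R.
  by rewrite lerXn2r ?nnegrE ?expR_ge0 //; lra.
move/le_trans; apply; rewrite !exprS expr0; lra.
Qed.

Lemma expR_le_exp4 (R : realType) (k : nat) : expR (5 / 4 * k%:R) <= (4 ^ k)%:R :> R.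
Proof.
by rewrite expRM_natr natrX lerXn2r ?nnegrE ?expR_ge0 // expR_5_4_le.
Qed.

(** This makes the expected number of hits on a block small against its sieve bound. *)
Lemma exp_neighbours_le (R : realType) (x : R) : 1000 <= x ->
  32 * expR (6 / 5 * x) <= expR (5 / 4 * (x - 3)).
Proof.
move=> x_ge; have -> : 5 / 4 * (x - 3) = (x / 20 - 15 / 4) + 6 / 5 * x by lra.
rewrite expRD ler_pM2r ?expR_gt0 //; apply: le_trans (expR_ge1Dx _); lra.
Qed.

(** The left side is the cost of the union bound over all blocks. After division an exponent of at
    least [3 x / 5] is left, and [exp (3 x / 5) >= (x / 5) ^ 3] beats the quadratic. *)
Lemma exp_concentration_ge (R : realType) (x : R) : 1000 <= x ->
  2 * (x + 1) ^+ 2 <= expR (5 / 4 * (x - 3)) / (2 * expR (3 / 5 * x)).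
Proof.
move=> x_ge; rewrite invfM [leRHS]mulrCA -expRN -expRD -ler_pdivrMl ?invr_gt0 // invrK.
have cube : (x / 5) ^+ 3 <= expR (3 / 5 * x).
  have -> : 3 / 5 * x = 3%:R * (x / 5) by lra.
  rewrite expRM_natl lerXn2r ?nnegrE ?expR_ge0 //; first lra.
  by apply: le_trans (expR_ge1Dx _); lra.
apply: (@le_trans _ _ ((x / 5) ^+ 3)).
  rewrite exprSr; nra.
apply: le_trans cube _; rewrite ler_expR; lra.
Qed.

(** * Existence of an unblocked choice *)

Section Existence.
Variables (R : realType) (K : nat).
Hypothesis K_ge : (1000 <= K)%N.
Notation a := (block K).
Notation q := (fun j => sieve_bound (block K j)).
Notation cand := (candidates K).
Notation kr := (fun j => (scale (block K j))%:R : R).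

Lemma sieve_bound_ge j : expR (5 / 4 * (kr j - 3)) <= (q j)%:R.
Proof.
have := expR_le_exp4 R (scale (a j) - 3).
by rewrite natrB // (leq_trans _ (scale_block_ge K_ge j)).
Qed.

(** The difference is [1 / ((j + 1) (j + 2))], and [j + 2 <= a j < 2 ^ ((k + 1) ^ 2)] turns the
    index into the scale. *)
Lemma inv_sub_ge j :
  expR (- (2 * (kr j + 1) ^+ 2)) <= (j.+1%:R)^-1 - (j.+2%:R)^-1 :> R.
Proof.
have j0 : 0 < j.+1%:R :> R by [].
have ja : j.+2%:R <= expR ((kr j + 1) ^+ 2).
  apply: (@le_trans _ _ (2 ^ ((scale (a j)).+1 ^ 2))%:R).
    by rewrite ler_nat ltnW // (leq_ltn_trans (block_ge K_ge j) (scale_gt _)).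
  have -> : (kr j + 1) ^+ 2 = ((scale (a j)).+1 ^ 2)%:R * 1.
    by rewrite mulr1 natrX natr1.
  rewrite natrX expRM_natl.
  rewrite lerXn2r ?nnegrE ?expR_ge0 //; have := expR_ge1Dx (1 : R); lra.
have -> : (j.+1%:R)^-1 - (j.+2%:R)^-1 = (j.+1%:R * j.+2%:R)^-1 :> R.
  rewrite -[j.+2%:R]natr1; move: j.+1%:R j0 => y y0; field.
  by rewrite !gt_eqF // addr_gt0.
rewrite expRN lef_pV2 ?posrE ?expR_gt0 ?mulr_gt0 //.
have -> : 2 * (kr j + 1) ^+ 2 = (kr j + 1) ^+ 2 + (kr j + 1) ^+ 2 by lra.
by rewrite expRD ler_pM // (le_trans _ ja) // ler_nat.
Qed.

Lemma exists_unblocked : exists f : nat -> nat,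
  (forall i, f i \in cand i) /\
  (forall i j, (j < i)%N -> ~~ blocks R (f i) (f j)).
Proof.
apply: transversal_compactness => M.
pose D j := expR (3 / 5 * kr j).
have D0 j : 0 < D j by apply: expR_gt0.
have q0 j : 0 < (q j)%:R :> R by rewrite ltr0n sieve_bound_gt0.
(* Of at least [3 q] candidates, [q] stay free and [2 q] may be blocked; [lam] is half the inverse
   of the maximal number of hits. *)
apply: (@finite_transversal R cand (blocks R) (fun i => (q i)%:R)
  (fun i => 2 * (q i)%:R) (fun j => 16 * expR (6 / 5 * kr j))
  (fun j => (2 * D j)^-1)) => //.
- by move=> j; rewrite invr_gt0 mulr_gt0.
- move=> i j s ji sc; rewrite invfM -mulrA ler_piMr // ?invr_ge0 //.
  by rewrite mulrC ler_pdivrMr // mul1r (count_blocks_le R K_ge ji sc).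
- move=> j; have -> : (q j)%:R + 2 * (q j)%:R = (3 * q j)%:R :> R by rewrite natrM; lra.
  by rewrite ler_nat size_candidates_ge.
- move=> j N.
  (* With [q i] lowered to [q j], exchanging sums counts, for each of at most [16 * q j] elements
     [t], the [s] that block it. *)
  apply: (@le_trans _ _ (\sum_(j.+1 <= i < N)
      (\sum_(s <- cand i) (count (blocks R s) (cand j))%:R) / (q j)%:R)).
    rewrite big_nat [leRHS]big_nat; apply: ler_sum => i /andP[ji _].
    rewrite ler_wpM2l ?sumr_ge0 // lef_pV2 ?posrE // ler_nat.
    exact: leq_sieve_bound (ltnW ji).
  rewrite -mulr_suml ler_pdivrMr //.
  have double_count i : \sum_(s <- cand i) (count (blocks R s) (cand j))%:R =
      \sum_(t <- cand j) (count (blocks R ^~ t) (cand i))%:R :> R.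
    rewrite -!natr_sum; congr _%:R.
    under eq_bigr do rewrite -sum1_count big_mkcond.
    by rewrite exchange_big; apply: eq_bigr => t _; rewrite -sum1_count [RHS]big_mkcond.
  under eq_bigr do rewrite double_count.
  rewrite exchange_big /=.
  under eq_bigr do rewrite -natr_sum.
  apply: (@le_trans _ _ (\sum_(t <- cand j) expR (6 / 5 * kr j))).
    rewrite big_seq [leRHS]big_seq; apply: ler_sum => t tc.
    apply: (@le_trans _ _ (size (admissible R t) ^ 2)%:R).
      by rewrite ler_nat (sum_blocks_le R K_ge N tc).
    have -> : 6 / 5 * kr j = 3 / 5 * kr j + 3 / 5 * kr j by lra.
    have := count_admissible_le R K_ge tc (candidates_gt0 K_ge tc) (leqnn t).
    by rewrite natrX expr2 expRD => adm_le; apply: ler_pM.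
  set E := expR _; have E0 : 0 <= E by apply: expR_ge0.
  rewrite big_const_seq count_predT iter_addr_0 -[E *+ _]mulr_natr.
  rewrite (_ : 16 * E * _ = E * (16 * q j)%:R); last by rewrite natrM; ring.
  by rewrite ler_wpM2l // ler_nat; apply: size_candidates_le.
move=> j; apply: le_trans (inv_sub_ge j); rewrite ler_expR.
(* Since [2 Q <= q], the distance [T - 2 Q] from the mean to the threshold is at least [q]. *)
have k_ge := kr_ge R K_ge j; have qk := sieve_bound_ge j.
have nb := exp_neighbours_le k_ge; have := exp_concentration_ge k_ge.
move=> conc; rewrite -[leLHS]opprK lerN2; apply: le_trans conc _.
rewrite -mulrN mulrC ler_pM2l ?invr_gt0 ?mulr_gt0 ?expR_gt0 //; lra.
Qed.

End Existence.

(** * The theorem *)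

(** With [r = y / x] in lowest terms, integrality of [g1 y ^ 2 / x ^ 2] forces [x ^ 2] to divide
    [g1]. *)
Lemma geom_prog3_nat (g1 g2 g3 : nat) : (0 < g1)%N ->
  geom_prog3 g1%:Z g2%:Z g3%:Z ->
  exists c x y, [/\ (g1 = c * x ^ 2)%N, (g2 = c * x * y)%N, (g3 = c * y ^ 2)%N
                  & (x < y)%N].
Proof.
move=> g1_gt0 [r [r_gt1 g2E g3E]].
have r_gt0 : 0 < r by apply: lt_trans r_gt1.
pose y := `|numq r|%N; pose x := `|denq r|%N.
have x_gt0 : (0 < x)%N by rewrite absz_gt0 denq_neq0.
have rE : r = y%:R / x%:R.
  rewrite -[LHS]divq_num_den /y /x !natr_absz !ger0_norm ?denq_ge0 //.
  by rewrite numq_ge0 ltW.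
have x0 : x%:R != 0 :> rat by rewrite pnatr_eq0 -lt0n.
have step (g g' : nat) : g'%:~R = r * g%:~R -> (g' * x = g * y)%N.
  rewrite rE => E; apply/eqP; rewrite -(eqr_nat rat) !natrM; apply/eqP.
  rewrite (_ : g'%:R = y%:R / x%:R * g%:R) //; field; exact: x0.
have {g2E} E12 := step _ _ g2E; have {g3E} E23 := step _ _ g3E.
have cop : coprime x y by rewrite coprime_sym coprime_num_den.
have xy : (x < y)%N.
  by move: r_gt1; rewrite rE ltr_pdivlMr ?ltr0n // mul1r ltr_nat.
have /dvdnP[h g1E] : (x %| g1)%N by rewrite -(Gauss_dvdl _ cop) -E12 dvdn_mull.
have {}E12 : g2 = (h * y)%N.
  by apply/eqP; rewrite -(eqn_pmul2r x_gt0) E12 g1E; apply/eqP; ring.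
have /dvdnP[c hE] : (x %| h)%N.
  by rewrite -(Gauss_dvdl _ cop) -(Gauss_dvdl _ cop) -E12 -E23 dvdn_mull.
exists c, x, y; split=> //.
- by rewrite g1E hE; ring.
- by rewrite E12 hE; ring.
by apply/eqP; rewrite -(eqn_pmul2r x_gt0) E23 E12 hE; apply/eqP; ring.
Qed.

Section Conclusion.
Variables (R : realType) (K : nat) (f : nat -> nat).
Hypothesis K_ge : (1000 <= K)%N.
Notation a := (block K).
Notation cand := (candidates K).
Hypothesis f_cand : forall i, f i \in cand i.

Lemma transversal_lt i j : (i < j)%N -> (f i < f j)%N.
Proof.
move=> ij; have [_ fi _] := candidatesP (f_cand i).
have [fj _ _] := candidatesP (f_cand j).
by apply: leq_trans fi _; apply: leq_trans fj; apply: (leq_block K ij).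
Qed.

(** The last two terms already form a forbidden pair; the first one makes [x] admissible, because
    [x ^ 2] divides it. *)
Lemma transversal_geom_prog3_free :
  (forall i j, (j < i)%N -> ~~ blocks R (f i) (f j)) ->
  geom_prog3_free (range (fun n : nat => (f n)%:Z)).
Proof.
move=> free _ _ _ [i1 _ <-] [i2 _ <-] [i3 _ <-].
have f_gt0 i : (0 < f i)%N by apply: candidates_gt0 (f_cand i).
move=> /(geom_prog3_nat (f_gt0 i1))[c [x [y [f1 f2 f3 xy]]]].
have y_gt0 : (0 < y)%N by apply: leq_ltn_trans xy.
have c_gt0 : (0 < c)%N by move: (f_gt0 i1); rewrite f1 muln_gt0 => /andP[].
have f23 : (f i2 < f i3)%N by rewrite f2 f3 -mulnn mulnA ltn_pmul2r // ltn_pmul2l.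
have i23 : (i2 < i3)%N.
  rewrite ltnNge leq_eqVlt; apply/negP => /orP[/eqP i32|/transversal_lt f32].
    by rewrite i32 ltnn in f23.
  by have := ltn_trans f23 f32; rewrite ltnn.
have /negP := free _ _ i23; apply.
have x_adm : x \in admissible R (f i2).
  rewrite mem_filter -dvdn_divisors //; apply/andP; split.
    by apply: (ilg_sum_candidates R K_ge (f_cand i1)); rewrite f1 dvdn_mull.
  by rewrite f2 mulnAC dvdn_mull.
have y_adm : y \in admissible R (f i2).
  rewrite mem_filter -dvdn_divisors //; apply/andP; split.
    by apply: (ilg_sum_candidates R K_ge (f_cand i3)); rewrite f3 dvdn_mull.
  by rewrite f2 dvdn_mull.
apply/hasP; exists y => //; rewrite {1}f3 dvdn_mull //=.
by apply/hasP; exists x => //; rewrite f2 f3; apply/eqP; ring.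
Qed.

(** Two consecutive blocks span at most [4 ^ k = exp (2 k ln 2)], and [2 ^ (k ^ 2) <= f i.+1] gives
    [k ln 2 <= sqrt (ln 2 * ln (f i.+1))]. *)
Lemma transversal_gap (i : nat) :
  (f i.+1)%:R - (f i)%:R <= expR (2 * Num.sqrt (ln 2 * ln (f i.+1)%:R)) :> R.
Proof.
have [fi _ _] := candidatesP (f_cand i).
have [fj fj' _] := candidatesP (f_cand i.+1).
pose k := scale (a i.+1).
have q_le := leq_sieve_bound K_ge (leqnSn i).
have k_ge : (1000 <= k)%N by apply: scale_block_ge.
have q4 : (32 * sieve_bound (a i.+1) <= 4 ^ k)%N.
  rewrite /sieve_bound -/k -{2}(subnK (leq_trans (isT : 3 <= 1000)%N k_ge)).
  by rewrite expnD mulnC leq_mul2l orbT.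
have gap : (f i.+1 <= f i + 4 ^ k)%N.
  have aE : a i.+1 = (a i + 16 * sieve_bound (a i))%N by [].
  lia.
rewrite lerBlDl; apply: (@le_trans _ _ (f i + 4 ^ k)%:R); first by rewrite ler_nat.
rewrite natrD lerD2l natrX -[4%:R]lnK ?posrE // -expRM_natl ler_expR.
rewrite (_ : 4%:R = 2 ^+ 2); last by rewrite -natrX.
rewrite lnXn // -[ln 2 *+ 2]mulr_natl mulrCA ler_pM2l //.
have ln2 := ln2_gt0 R.
rewrite -[leLHS]ger0_norm ?mulr_ge0 ?(ltW ln2) // -sqrtr_sqr ler_wsqrtr //.
rewrite expr2 mulrACA mulrC -[_ * _ * _]mulrA ler_pM2l //.
have : (2 ^ (k ^ 2) <= f i.+1)%N by apply: leq_trans (scale_le (block_gt0 K_ge _)) fj.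
move=> /(ler_lg R); rewrite expn_gt0 => /(_ isT).
rewrite lgX2 /lg ler_pdivlMr // natrX expr2; apply: le_trans.
by rewrite mulrC.
Qed.

End Conclusion.

(* The sequence is indexed from 0: [t n] is the (n+1)-st term. *)
Theorem theorem1p3 (R : realType) (eps : R) (eps_gt0 : 0 < eps) :
  exists t : nat -> nat,
    [/\ forall n : nat, (0 < t n)%N,
        forall n : nat, (t n < t n.+1)%N,
        geom_prog3_free (range (fun n : nat => (t n)%:Z))
      & forall n : nat,
          let L : R := ln (t n.+1)%:R in
          (t n.+1)%:R - (t n)%:R <=
          expR (2 * Num.sqrt (ln 2 * L +
            (3 + eps) / 2 * Num.sqrt (ln 2 * L) * ln L))].
Proof.
have [K K_ge] : exists K, (1000 <= K)%N by exists 1000%N.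
have [f [f_cand f_free]] := exists_unblocked R K_ge.
exists f; split=> [n|n| |n /=].
- exact (candidates_gt0 K_ge (f_cand n)).
- exact: (transversal_lt f_cand).
- exact: transversal_geom_prog3_free K_ge f_cand f_free.
apply: le_trans (transversal_gap R K_ge f_cand n) _.
rewrite ler_expR ler_pM2l // ler_wsqrtr // lerDl.
have coef_ge0 : 0 <= (3 + eps) / 2 by lra.
apply: mulr_ge0; first by rewrite mulr_ge0 ?sqrtr_ge0.
apply: ln_ge0.
(* [ln L >= 0] requires [f n.+1 >= e], and [e <= exp (5 / 4) <= 4]. *)
have f4 : (4 <= f n.+1)%N.
  have [fa _ _] := candidatesP (f_cand n.+1); apply: leq_trans fa.
  apply: leq_trans (scale_le (block_gt0 K_ge n.+1)).
  rewrite (@leq_exp2l 2 2) //; have := scale_block_ge K_ge n.+1.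
  move: (scale _) => k hk; rewrite -mulnn; nia.
rewrite -[leLHS]expRK ler_ln ?posrE ?expR_gt0 ?ltr0n ?(leq_trans _ f4) //.
apply: (@le_trans _ _ 4); last by rewrite ler_nat.
by apply: le_trans (expR_5_4_le R); rewrite ler_expR; lra.
Qed.
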